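(* Let $\Omega\subset\mathbb{R}^n$ be open and let $p\ge 2$. For $v\in C^2(\Omega)$ define $w:\Omega\times\mathbb{R}\to\mathbb{R}$ by $w(x,x_{n+1})=v(x)+x_{n+1}$. Then $$\operatorname{div}\bigl((1+|Dv|^2)^{p/2-1}Dv\bigr)=0\quad\text{in }\Omega$$ if and only if $$\Delta_p w=\operatorname{div}\bigl(|Dw|^{p-2}Dw\bigr)=0\quad\text{in }\Omega\times\mathbb{R}.$$
   Context: $D$ denotes the gradient and $|\cdot|$ the Euclidean norm. The first divergence is taken in $\mathbb{R}^n$; the second one (and the gradient $Dw$) is taken in $\mathbb{R}^{n+1}$ with respect to all variables $(x,x_{n+1})$. *)

(* Defs.v *)
From mathcomp Require Import all_boot all_order all_algebra.
From mathcomp Require Import all_classical all_reals all_analysis.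

Set Implicit Arguments.
Unset Strict Implicit.
Unset Printing Implicit Defensive.

Import Order.TTheory GRing.Theory Num.Theory.
Import numFieldNormedType.Exports.

Local Open Scope classical_set_scope.
Local Open Scope ring_scope.

(* Points and vectors of R^n are row vectors.  The library norm `|u| on
   'rV[R]_n is the sup norm, hence the separate Euclidean norm [enorm]; the two
   induce the same topology.  Functions on an open set are represented by total
   functions, only the values on that set being relevant. *)

Section Calculus.
Variables (R : realType) (n : nat).
Implicit Types (f : 'rV[R]_n -> R) (F : 'rV[R]_n -> 'rV[R]_n).

Definition enorm (u : 'rV[R]_n) : R := Num.sqrt (\sum_(i < n) u 0 i ^+ 2).

Definition basis_vec (i : 'I_n) : 'rV[R]_n := delta_mx 0 i.

Definition partial (i : 'I_n) f (x : 'rV[R]_n) : R := 'D_(basis_vec i) f x.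

Definition grad f (x : 'rV[R]_n) : 'rV[R]_n := \row_(i < n) partial i f x.

Definition divergence F (x : 'rV[R]_n) : R :=
  \sum_(i < n) partial i (fun y => F y 0 i) x.

(* C^k on an open set A: all partial derivatives of order at most k exist and
   are continuous on A. *)
Fixpoint Ck (k : nat) (A : set 'rV[R]_n) f : Prop :=
  {in A, continuous f} /\
  if k is k'.+1 then
    forall i, {in A, forall x, derivable f x (basis_vec i)} /\
              Ck k' A (partial i f)
  else True.

Definition plaplacian (p : R) f : 'rV[R]_n -> R :=
  divergence (fun x => enorm (grad f x) `^ (p - 2) *: grad f x).

End Calculus.

(* R^n x R is identified with 'rV[R]_(n + 1): the point (x, t) is
   row_mx x t%:M, so that x is [lsubmx z] and x_{n+1} is [z 0 (rshift n ord0)]. *)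

Definition cylinder (R : realType) (n : nat) (Omega : set 'rV[R]_n) :
    set 'rV[R]_(n + 1) :=
  [set z | Omega (lsubmx z)].

Definition add_last (R : realType) (n : nat) (v : 'rV[R]_n -> R)
    (z : 'rV[R]_(n + 1)) : R :=
  v (lsubmx z) + z 0 (rshift n ord0).

(* Main.v *)
(** Along the coordinates of R^n the difference quotients of a function of
    (x, t) that depends on t only through an added [t] are those of its
    restriction to R^n, so Dw(x, t) = (Dv(x), 1) and |Dw|^2 = 1 + |Dv|^2.
    The field |Dw|^(p-2) Dw does not depend on t, so its divergence at (x, t)
    is that of its first n components at x. *)

Require Import Defs.
From mathcomp Require Import all_boot all_order all_algebra.
From mathcomp Require Import all_classical all_reals all_analysis.
From mathcomp Require Import ring.
Import Order.TTheory GRing.Theory Num.Theory.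
Import numFieldNormedType.Exports.
Local Open Scope classical_set_scope.
Local Open Scope ring_scope.

(** A directional derivative sees only the increments along one line, so it can be compared across
    two different spaces. Under the hypothesis the two difference quotients are one and the same
    function of [h], hence so are the values [lim] assigns to them, whether or not they converge. *)
Lemma eq_line_derive (R : realType) (U V : normedModType R) (f : U -> R)
    (g : V -> R) (x u : U) (y w : V) :
  (forall h : R, f (h *: u + x) - f x = g (h *: w + y) - g y) ->
  'D_u f x = 'D_w g y.
Proof.
move=> efg; rewrite /derive.
suff -> : (fun h : R => h^-1 *: ((f \o shift x) (h *: u) - f x)) =
          (fun h : R => h^-1 *: ((g \o shift y) (h *: w) - g y)) by [].
by apply/funext => h /=; rewrite efg.
Qed.

Lemma lsubmx_line_lshift (R : realType) (n : nat) (i : 'I_n) (h : R)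
    (z : 'rV[R]_(n + 1)) :
  lsubmx (h *: basis_vec R (lshift 1 i) + z) =
  h *: basis_vec R i + lsubmx z.
Proof.
by apply/rowP => j; rewrite !mxE /= (inj_eq (@lshift_inj _ _)).
Qed.

Lemma lsubmx_line_rshift (R : realType) (n : nat) (h : R)
    (z : 'rV[R]_(n + 1)) :
  lsubmx (h *: basis_vec R (rshift n ord0) + z) = lsubmx z.
Proof.
by apply/rowP => j; rewrite !mxE eq_lrshift andbF mulr0 add0r.
Qed.

Lemma partial_lsubmx_lshift (R : realType) (n : nat) (g : 'rV[R]_n -> R)
    (i : 'I_n) (z : 'rV[R]_(n + 1)) :
  partial (lshift 1 i) (g \o lsubmx) z = partial i g (lsubmx z).
Proof.
by apply: eq_line_derive => h /=; rewrite lsubmx_line_lshift.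
Qed.

Lemma partial_lsubmx_rshift (R : realType) (n : nat) (g : 'rV[R]_n -> R)
    (z : 'rV[R]_(n + 1)) :
  partial (rshift n ord0) (g \o lsubmx) z = 0.
Proof.
rewrite /partial /derive; apply/cvg_lim => //.
rewrite [X in X @ _](_ : _ = cst 0); first exact: cvg_cst.
by apply/funext => h /=; rewrite lsubmx_line_rshift subrr scaler0.
Qed.

Lemma divergence_lsubmx (R : realType) (n : nat)
    (F : 'rV[R]_n -> 'rV[R]_(n + 1)) (z : 'rV[R]_(n + 1)) :
  divergence (F \o lsubmx) z = divergence (lsubmx \o F) (lsubmx z).
Proof.
rewrite /divergence big_split_ord big_ord1 /=.
(* The last component factors through [lsubmx] only up to conversion, so the function on R^n is
   supplied explicitly. *)
have -> : partial (rshift n ord0) (fun y => F (lsubmx y) 0 (rshift n ord0)) z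
          = 0 := partial_lsubmx_rshift _ _ (fun x => F x 0 (rshift n ord0)) z.
rewrite addr0; apply: eq_bigr => i _.
rewrite -partial_lsubmx_lshift; congr partial; apply/funext => y /=.
by rewrite mxE.
Qed.

Lemma partial_add_last_lshift (R : realType) (n : nat) (v : 'rV[R]_n -> R)
    (i : 'I_n) (z : 'rV[R]_(n + 1)) :
  partial (lshift 1 i) (add_last v) z = partial i v (lsubmx z).
Proof.
apply: eq_line_derive => h.
rewrite /add_last lsubmx_line_lshift !mxE eq_rlshift andbF mulr0 add0r; ring.
Qed.

Lemma partial_add_last_rshift (R : realType) (n : nat) (v : 'rV[R]_n -> R)
    (z : 'rV[R]_(n + 1)) :
  partial (rshift n ord0) (add_last v) z = 1.
Proof.
rewrite /partial /derive; apply/cvg_lim => //.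
(* The quotient is [h^-1 * h], which is 1 only for nonzero [h]; this suffices, since the limit is
   taken over punctured neighbourhoods of 0. *)
apply: (@cvg_trans _ (cst (1 : R) @ (0 : R)^')); last exact: cvg_cst.
apply: near_eq_cvg; near=> h.
rewrite /= /add_last lsubmx_line_rshift !mxE !eqxx mulr1.
have -> : v (lsubmx z) + (h + z 0 (rshift n ord0)) -
  (v (lsubmx z) + z 0 (rshift n ord0)) = h by ring.
by rewrite /cst /GRing.scale /= mulVf //; near: h; exact: nbhs_dnbhs_neq.
Unshelve. all: by end_near.
Qed.

Lemma grad_add_last (R : realType) (n : nat) (v : 'rV[R]_n -> R)
    (z : 'rV[R]_(n + 1)) :
  grad (add_last v) z = row_mx (grad v (lsubmx z)) 1%:M.
Proof.
apply/rowP => j; case: (split_ordP j) => k ->.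
  by rewrite row_mxEl !mxE partial_add_last_lshift.
by rewrite row_mxEr ord1 !mxE partial_add_last_rshift.
Qed.

Lemma enorm_row_mx1 (R : realType) (n : nat) (u : 'rV[R]_n) :
  enorm (row_mx u (1%:M : 'rV[R]_1)) = Num.sqrt (1 + enorm u ^+ 2).
Proof.
rewrite /enorm sqr_sqrtr ?sumr_ge0// => [|i _]; last exact: sqr_ge0.
rewrite big_split_ord big_ord1 row_mxEr mxE expr1n addrC.
by under eq_bigr do rewrite row_mxEl.
Qed.

(** Writing the root as the power 1/2 multiplies the exponent by 1/2; with a = 1 + |Dv|^2 this turns
    the weight of the p-Laplacian of w into that of the equation for v. *)
Lemma sqrt_powR_sub2 (R : realType) (a p : R) : 0 <= a ->
  Num.sqrt a `^ (p - 2) = a `^ (p / 2 - 1).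
Proof.
move=> a0; rewrite -powR12_sqrt// -powRrM; congr (_ `^ _).
by rewrite mulrBr mulVf ?pnatr_eq0// mulrC.
Qed.

(** As the two operators agree point by point, the equivalence reduces to matching points of the
    cylinder with points of Omega. *)
Lemma plaplacian_add_last (R : realType) (n : nat) (p : R)
    (v : 'rV[R]_n -> R) (z : 'rV[R]_(n + 1)) :
  plaplacian p (add_last v) z =
  divergence (fun y => (1 + enorm (grad v y) ^+ 2) `^ (p / 2 - 1)
                         *: grad v y) (lsubmx z).
Proof.
rewrite /plaplacian.
(* The whole field is rewritten, not just its value at [z], so that its independence of t shows as a
   composition with [lsubmx]. *)
have -> : (fun y => enorm (grad (add_last v) y) `^ (p - 2) *:
                    grad (add_last v) y) =
    (fun x => (1 + enorm (grad v x) ^+ 2) `^ (p / 2 - 1) *: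
              row_mx (grad v x) (1%:M : 'rV[R]_1)) \o lsubmx.
  apply/funext => y /=; rewrite grad_add_last enorm_row_mx1 sqrt_powR_sub2 //.
  by rewrite addr_ge0 ?sqr_ge0.
rewrite divergence_lsubmx; congr divergence; apply/funext => x /=.
by rewrite linearZ /= row_mxKl.
Qed.

Theorem proposition2p2 (R : realType) (n : nat) (Omega : set 'rV[R]_n)
    (p : R) (v : 'rV[R]_n -> R) :
  open Omega -> 2 <= p -> Ck 2 Omega v ->
  (forall x : 'rV[R]_n, Omega x ->
     divergence (fun y => (1 + enorm (grad v y) ^+ 2) `^ (p / 2 - 1)
                            *: grad v y) x = 0)
  <->
  (forall z : 'rV[R]_(n + 1), cylinder Omega z ->
     plaplacian p (add_last v) z = 0).
Proof.
move=> _ _ _; split=> [divv0 z Oz|pw0 x Ox].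
  by rewrite plaplacian_add_last; exact: divv0.
(* The point x is lifted to height 0; any other height would serve as well. *)
have := pw0 (row_mx x 0); rewrite plaplacian_add_last /cylinder /= row_mxKl.
exact.
Qed.
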